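(* For every positive integer $k$, there exist infinitely many integers $n\ge 3$ for which the equation $$F_nx+F_{n+1}y=\frac{(F_n-1)(F_{n+1}-1)}{k}$$ has an integral solution with $x=y>0$. More precisely, if $n$ is a positive even integer and $F_{n-1}\equiv 1\pmod k$, then $$x=y=\frac{F_{n-1}-1}{k}$$ is a solution of this equation.
   Context: $(F_n)$ is the Fibonacci sequence with $F_1=F_2=1$ and $F_n=F_{n-1}+F_{n-2}$ for all $n\in\mathbb{Z}$. *)

(* Defs.v *)
From mathcomp Require Import all_boot all_order all_algebra.
From mathcomp Require Import classical_sets cardinality.

Set Implicit Arguments.
Unset Strict Implicit.
Unset Printing Implicit Defensive.

Import GRing.Theory Num.Theory.
Local Open Scope ring_scope.

Definition fib_next (p : int * int) : int * int := (p.2, p.1 + p.2).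
Definition fib_prev (p : int * int) : int * int := (p.2 - p.1, p.1).

(* fib_pair n = (F_n, F_(n+1)), starting from (F_0, F_1) = (0, 1); the
   recurrence is run backwards for negative indices. *)
Definition fib_pair (n : int) : int * int :=
  match n with
  | Posz m => iter m fib_next (0, 1)
  | Negz m => iter m.+1 fib_prev (0, 1)
  end.

Definition fib (n : int) : int := (fib_pair n).1.

Lemma fib_pairS (n : int) : fib_pair (n + 1) = fib_next (fib_pair n).
Proof.
have prevK p : fib_next (fib_prev p) = p.
  by case: p => a b; rewrite /fib_next /fib_prev /= subrK.
case: n => [m|[|m]] //; first by rewrite -PoszD addn1.
suff -> : Negz m.+1 + 1 = Negz m by rewrite /fib_pair [in RHS]iterS prevK.
by rewrite !NegzE -(addn1 m.+1) PoszD opprD subrK.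
Qed.

Lemma fib1 : fib 1 = 1. Proof. by []. Qed.

Lemma fib2 : fib 2 = 1. Proof. by []. Qed.

Lemma fib_rec (n : int) : fib n = fib (n - 1) + fib (n - 2).
Proof.
have step m : fib (m + 1 + 1) = fib (m + 1) + fib m.
  by rewrite /fib !fib_pairS /= addrC.
have e1 : n - 1 = n - 2 + 1 by rewrite -addrA.
by rewrite e1 -step -e1 subrK.
Qed.

(* The right-hand side need not be an integer, so the equation is read in the
   rationals, with integral unknowns x and y. *)
Definition is_solution (k n x y : int) : Prop :=
  (fib n)%:~R * x%:~R + (fib (n + 1))%:~R * y%:~R
    = ((fib n - 1) * (fib (n + 1) - 1))%:~R / k%:~R :> rat.

(* Main.v *)
Require Import Defs.
From mathcomp Require Import all_boot all_order all_algebra.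
From mathcomp Require Import classical_sets cardinality.
From mathcomp Require Import zify ring.

(** Write [a = F_(n-1)], [b = F_n], so that [F_(n+1) = a + b].  For even [n],
    Cassini's identity (lemma [fib_cassini]) reads [b^2 - a b - a^2 = -1],
    which is the same as
      [(b + (a + b)) (a - 1) = (b - 1) (a + b - 1)].
    Dividing by [k] shows that [x = y = (F_(n-1) - 1) / k] solves the equation,
    and this is an integer as soon as [F_(n-1)] is [1] modulo [k]
    (lemma [is_solution_diag]).

    There are infinitely many such [n]: the Fibonacci recurrence acts on pairs
    of residues (modulo [k], or any multiple of it) as an injection of a finite
    set, so the orbit of the initial pair is purely periodic, of some period
    [T > 0] (lemma [fib_mod_period]).  Hence every [n = 2 T (m + 1) + 2] satisfies
    [F_(n-1) = F_1 = 1] modulo [k]; it is even, at least [4], and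
    [F_(n-1) > 1] makes the solution positive. *)

Local Open Scope classical_set_scope.
Local Open Scope ring_scope.

Import Order.TTheory GRing.Theory Num.Theory.

Lemma fibSS (m : nat) : fib m.+2 = fib m.+1 + fib m.
Proof. by rewrite /fib /= addrC. Qed.

Lemma fib_cassini (m : nat) :
  fib m.+1 ^+ 2 - fib m.+1 * fib m - fib m ^+ 2 = (-1) ^+ m.
Proof.
elim: m => [|m IHm] //.
by rewrite fibSS [RHS]exprS -IHm; ring.
Qed.

Lemma fib_gt0 (m : nat) : 0 < fib m.+1.
Proof.
suff [] : 0 < fib m.+1 /\ 0 < fib m.+2 by [].
by elim: m => [//|m [h1 h2]]; rewrite (fibSS m.+1); split; lia.
Qed.

Lemma fib_gt1 (m : nat) : 1 < fib m.+3.
Proof.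
by rewrite fibSS; have := fib_gt0 m; have := fib_gt0 m.+1; lia.
Qed.

(** The equation at the even index [n = m + 1], so that [F_(n-1)] is [fib m]
    and [x] is [(F_(n-1) - 1) / k]. *)
Lemma is_solution_diag (k : int) (m : nat) (x : int) :
  0 < k -> odd m -> fib m - 1 = x * k -> is_solution k m.+1 x x.
Proof.
move=> k_gt0 m_odd def_x; rewrite /is_solution -PoszD addn1.
have kQ : k%:~R != 0 :> rat by rewrite intr_eq0 gt_eqF.
apply: (canRL (mulfK kQ)).
rewrite -!rmorphM -rmorphD -rmorphM; congr (_%:~R).
have cassini := fib_cassini m; rewrite -signr_odd m_odd expr1 in cassini.
rewrite -mulrDl -mulrA -def_x fibSS.
move: cassini; set a := fib m; set b := fib m.+1 => cassini.
suff : (b + (b + a)) * (a - 1) - (b - 1) * (b + a - 1)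
       = - (b ^+ 2 - b * a - a ^+ 2) - 1 by rewrite cassini; lia.
ring.
Qed.

(** The Fibonacci step [(a, b) |-> (b, a + b)] in an arbitrary abelian group,
    used below for residues modulo a natural number. *)
Definition fib_step (V : zmodType) (p : V * V) : V * V := (p.2, p.1 + p.2).

Lemma fib_step_inj (V : zmodType) : injective (@fib_step V).
Proof. by move=> [a b] [c d] [/= -> /addIr ->]. Qed.

Lemma fib_residue (R : pzRingType) (m : nat) :
  ((fib m)%:~R, (fib m.+1)%:~R) = iter m (@fib_step R) (0, 1).
Proof.
elim: m => [|m IHm] //.
by rewrite iterS -IHm fibSS rmorphD addrC.
Qed.

(** Indices at which [F] returns to [F_1 = 1] modulo [k].  The period [T] is the
    length of the orbit of [(0, 1)] under the Fibonacci step; it closes up on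
    [(0, 1)] itself because the step is injective. *)
Lemma fib_mod_period (k : int) : 0 < k ->
  exists2 T : nat, (0 < T)%N &
    forall j : nat, (k %| fib (T * j).+1 - 1)%Z.
Proof.
case: k => // k k_gt0.
(* The ring of residues modulo [2 k] is nontrivial even when [k = 1]. *)
pose p := (2 * k)%N; have p_gt1 : (1 < p)%N by rewrite /p; lia.
pose z : 'Z_p * 'Z_p := (0, 1).
pose T := fingraph.order (@fib_step 'Z_p) z.
exists T => [|j]; first exact: fingraph.order_gt0.
have iterT : iter (T * j) (@fib_step 'Z_p) z = z.
  elim: j => [|j IHj]; first by rewrite muln0.
  by rewrite mulnS iterD IHj (fingraph.iter_order (@fib_step_inj _)).
have := fib_residue 'Z_p (T * j); rewrite -/z iterT => -[_ res1].
have := fib_gt0 (T * j); case: (fib _) res1 => // -[//|f] res1 _.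
have -> : Posz f.+1 - 1 = f by lia.
have /(congr1 (@nat_of_ord _)) : (f%:R : 'Z_p) = 0.
  by apply: (addIr 1); rewrite add0r -[RHS]res1; apply: natr1.
rewrite val_Zp_nat //= => /eqP f_mod.
by apply: dvdn_trans f_mod; rewrite dvdn_mull.
Qed.

Theorem theorem3p8 (k : int) (hk : 0 < k) :
  infinite_set [set n : int | 3 <= n /\
    exists x y : int, [/\ is_solution k n x y, x = y & 0 < y]] /\
  (forall n : int, 0 < n -> (2 %| n)%Z -> (fib (n - 1) = 1 %[mod k])%Z ->
    exists x y : int,
      [/\ x = y, y%:~R = (fib (n - 1) - 1)%:~R / k%:~R :> rat
        & is_solution k n x y]).
Proof.
split.
  have [T T_gt0 period] := fib_mod_period _ hk.
  (* [m + 1] rather than [m] excludes [n = 2], where [F_(n-1) - 1 = 0]. *)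
  pose f (m : nat) : int := (T * (2 * m.+1)).+2.
  have f_inj : injective f.
    by move=> i j [] /eqP; rewrite !eqn_pmul2l // => /eqP[].
  set A := [set n : int | _] => finA; apply: infinite_nat.
  suff <- : f @^-1` A = setT by apply: finite_preimage finA => i j _ _ /f_inj.
  apply/seteqP; split=> // m _; rewrite /A /f /=.
  split; first by nia.
  have /dvdzP[x def_x] := period (2 * m.+1)%N.
  exists x, x; split=> //.
    by apply: is_solution_diag => //=; rewrite oddM oddM andbF.
  rewrite -(pmulr_lgt0 _ hk) -def_x subr_gt0.
  have: (2 <= T * (2 * m.+1))%N by nia.
  by case: (T * _)%N => [|[|t]] // _; apply: fib_gt1.
case=> // -[//|m] _ m_even.
have -> : Posz m.+1 - 1 = m by lia.
move/eqP; rewrite eqz_mod_dvd => /dvdzP[x def_x].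
exists x, x; split=> //.
  by rewrite def_x rmorphM mulfK // intr_eq0 gt_eqF.
by apply: is_solution_diag => //; lia.
Qed.
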